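(* Let $\alpha,\beta,\gamma,\delta$ be real constants with $\alpha>0$ and $\delta>0$, and assume that $\max(\beta,\gamma)\geq 0$ or $\beta\gamma<\alpha\delta$. Then for any starting point $(x,y)$ with $x\geq 0$, $y\geq 0$, there exists a unique solution $(x(\cdot),y(\cdot))$ on $[0,\infty)$ to the integral system $$x(t)=x+\alpha\int_0^t\frac{ds}{x(s)}+\beta\int_0^t\frac{ds}{y(s)},\qquad y(t)=y+\gamma\int_0^t\frac{ds}{x(s)}+\delta\int_0^t\frac{ds}{y(s)},\qquad t\geq 0.$$
   Context: A solution to the integral system is a pair of continuous functions $x(\cdot),y(\cdot):[0,\infty)\to[0,\infty)$ satisfying the two equations for all $t\geq0$ and such that for every $t\geq 0$: the sets $\{s\in[0,t]:x(s)=0\}$ and $\{s\in[0,t]:y(s)=0\}$ have Lebesgue measure zero, and $\int_0^t \mathbf 1_{\{x(s)>0\}}\frac{ds}{x(s)}<\infty$, $\int_0^t \mathbf 1_{\{y(s)>0\}}\frac{ds}{y(s)}<\infty$. *)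

(* Defs.v *)
From HB Require Import structures.
From mathcomp Require Import all_boot all_order all_algebra.
From mathcomp Require Import all_classical all_reals all_analysis.
Import Order.TTheory GRing.Theory Num.Theory.
Import numFieldNormedType.Exports.

Set Implicit Arguments.
Unset Strict Implicit.
Unset Printing Implicit Defensive.

Local Open Scope classical_set_scope.
Local Open Scope ring_scope.

(* A function [0, +oo) -> [0, +oo) is represented by a function R -> R of which
   only the restriction to [0, +oo) matters. *)
Record admissible_path (R : realType) (x : R -> R) : Prop := {
  path_continuous : {within `[0, +oo[, continuous x};
  path_nonneg : forall t : R, 0 <= t -> 0 <= x t;
  path_zeros_null : forall t : R, 0 <= t ->
    lebesgue_measure [set s : R | s \in `[0, t] /\ x s = 0] = 0%E;
  path_inv_integral_finite : forall t : R, 0 <= t ->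
    (\int[lebesgue_measure]_(s in `[0%R, t])
       (\1_[set r : R | (0 < x r)%R] s * (x s)^-1)%:E < +oo)%E
}.

(* The inverse of 0 in R is 0.  For an admissible path this convention does not
   affect the integral of 1 / x over [0, t]: the zeros of x in [0, t] form a
   null set, and the integral is finite, so it is also the real number denoted
   by Rintegral. *)
Definition inv_integral (R : realType) (x : R -> R) (t : R) : R :=
  \int[lebesgue_measure]_(s in `[0, t]) (x s)^-1.

Record is_solution (R : realType) (alpha beta gamma delta x0 y0 : R)
    (x y : R -> R) : Prop := {
  solution_path_x : admissible_path x;
  solution_path_y : admissible_path y;
  solution_eq_x : forall t : R, 0 <= t ->
    x t = x0 + alpha * inv_integral x t + beta * inv_integral y t;
  solution_eq_y : forall t : R, 0 <= t ->
    y t = y0 + gamma * inv_integral x t + delta * inv_integral y t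
}.

(* Main.v *)
(* Write A, B for the integrals of 1 / x and 1 / y.  In the time scale
   du = dt / (x y) the system is linear: dx/du = beta x + alpha y and
   dy/du = delta x + gamma y.  The hypothesis on the parameters says exactly that
   the top eigenvalue l1 of this system is positive.  With k, m > 0 such that
   k m = alpha delta and k - m = gamma - beta, the left eigenvectors are
   v = delta x + k y, for l1 = beta + k, and w = delta x - m y, for
   l2 = beta - m.
   - Since v = v(0) + l1 (k A + delta B), the function v increases and the
     integrals are finite; so a solution is the same thing as a continuous
     trajectory that is positive for t > 0 and solves the differential equations
     there (it cannot touch an axis, because the repulsion dominates near it).
   - If v(0) > 0, then L = ln (v / v(0)) / l1 is the time change u, so that x and y
     are explicit functions X(L), Y(L), and T(L(t)) = t where T' = X Y > 0;
     hence L is the inverse of T, which gives uniqueness and existence.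
   - From the origin, |w| exp(- l2 L) is constant and at most
     C exp((l1 - l2) L), which vanishes at time 0; so w = 0, and y ^ 2 is
     proportional to t. *)
Require Import Defs.
From mathcomp Require Import all_boot all_order all_algebra.
From mathcomp Require Import all_classical all_reals all_analysis.
From mathcomp Require Import measurable_realfun.
From mathcomp Require Import ring lra.
Set Implicit Arguments.
Unset Strict Implicit.
Unset Printing Implicit Defensive.
Import Order.TTheory GRing.Theory Num.Theory.
Import numFieldNormedType.Exports.
Local Open Scope classical_set_scope.
Local Open Scope ring_scope.

(** * Paths on the half-line and integrals of their inverses *)

Local Notation continuous_on_halfline x := {within `[0, +oo[, continuous x}.

Lemma path_continuous_at {R : realType} (x : R -> R) (t : R) :
  continuous_on_halfline x -> 0 < t -> {for t, continuous x}.
Proof.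
by move=> /continuous_within_itvcyP[xc _] t0; apply: xc; rewrite in_itv/= t0.
Qed.

Lemma path_continuousW {R : realType} (x : R -> R) (s t : R) :
  continuous_on_halfline x -> 0 <= s -> {within `[s, t], continuous x}.
Proof.
move=> xc s0; apply: continuous_subspaceW xc => r /=.
by rewrite !in_itv/= => /andP[sr _]; rewrite (le_trans s0).
Qed.

Lemma measurable_path_inv {R : realType} (x : R -> R) (t : R) :
  continuous_on_halfline x -> (forall s, 0 <= s -> 0 <= x s) ->
  measurable_fun `[0, t] (fun s => (x s)^-1).
Proof.
move=> xc x0.
(* On nonnegative reals inversion is the power of exponent -1, also at 0, where both give 0. *)
apply: (eq_measurable_fun (fun s => x s `^ (-1))) => [s|].
  by rewrite inE/= in_itv/= => /andP[s0 _]; rewrite powR_inv1 ?x0.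
apply: (measurableT_comp (measurable_powR _)).
apply: subspace_continuous_measurable_fun => //.
exact: path_continuousW.
Qed.

Lemma integrable_path_inv0 {R : realType} (x : R -> R) (t : R) :
  admissible_path x -> 0 <= t ->
  lebesgue_measure.-integrable `[0, t] (EFin \o (fun s => (x s)^-1)).
Proof.
move=> [xc x0 _ xfin] t0; apply/integrableP; split.
  by apply/measurable_EFinP; exact: measurable_path_inv.
apply: le_lt_trans (xfin t t0); rewrite le_eqVlt; apply/orP; left; apply/eqP.
apply: eq_integral => s; rewrite inE/= in_itv/= => /andP[s0 _].
rewrite ger0_norm ?invr_ge0 ?x0// indicE; congr EFin.
have := x0 _ s0; rewrite le_eqVlt => /predU1P[<-|xs].
  by rewrite invr0 mulr0.
by rewrite mem_set// mul1r.
Qed.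

Lemma integrable_path_inv {R : realType} (x : R -> R) (s t : R) :
  admissible_path x -> 0 <= s -> s <= t ->
  lebesgue_measure.-integrable `[s, t] (EFin \o (fun s => (x s)^-1)).
Proof.
move=> xp s0 st.
apply: (@integrableS _ _ _ lebesgue_measure `[0, t]) => //.
  by move=> r /=; rewrite !in_itv/= => /andP[sr ->]; rewrite (le_trans s0).
by apply: integrable_path_inv0 => //; exact: le_trans st.
Qed.

Section locally_integrable_primitive.
Context {R : realType} (f : R -> R).
Hypothesis fint : forall t : R, 0 <= t ->
  lebesgue_measure.-integrable `[0, t] (EFin \o f).
Local Notation F t := (\int[lebesgue_measure]_(s in `[0, t]) f s).

Lemma primitive0 : F 0 = 0.
Proof. by rewrite set_itv1 Rintegral_set1. Qed.

Lemma primitive_continuous : continuous_on_halfline (fun t => F t).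
Proof.
have cF (t : R) : 0 < t -> {within `[0, t], continuous (fun t => F t)}.
  by move=> t0; apply: parameterized_integral_continuous; [exact: ltW|exact/fint/ltW].
apply/continuous_within_itvcyP; split=> [t|].
  rewrite in_itv/= andbT => t0.
  have t1 : t < t + 1 by lra.
  have ty := lt_trans t0 t1.
  have [+ _ _] := (continuous_within_itvP (fun t => F t) ty).1 (cF _ ty).
  by apply; rewrite in_itv/= t0.
by have [] := (continuous_within_itvP (fun t => F t) ltr01).1 (cF _ ltr01).
Qed.

Lemma primitive_is_derive (t : R) : 0 < t -> {for t, continuous f} ->
  is_derive t 1 (fun t => F t) (f t).
Proof.
move=> t0 ft; have t1 : t < t + 1 by lra.
have ft1 := fint (ltW (lt_trans t0 t1)).
have [dF <-] := continuous_FTC1_closed t1 ft1 t0 ft.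
by rewrite derive1E; exact/derivableP.
Qed.

Lemma primitiveB (s t : R) : 0 <= s -> s <= t ->
  F t - F s = \int[lebesgue_measure]_(r in `[s, t]) f r.
Proof.
move=> s0 st; rewrite Rintegral_itvB ?bnd_simp//; last exact/fint/(le_trans s0).
apply: Rintegral_itv_obnd_cbnd.
apply: integrableS (fint (le_trans s0 st)) => // r /=.
by rewrite !in_itv/= => /andP[/ltW sr ->]; rewrite (le_trans s0).
Qed.

End locally_integrable_primitive.

(** The bound on x passes to inverses only where x > 0, since the inverse of 0 is 0. The zeros form
    a null set, so the integrands are compared almost everywhere. *)
Lemma inv_integral_itv_ge {R : realType} (x : R -> R) (s t c : R) :
  admissible_path x -> 0 <= s -> s <= t -> 0 < c ->
  (forall r, s <= r <= t -> x r <= c) ->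
  (t - s) / c <= inv_integral x t - inv_integral x s.
Proof.
move=> xp s0 st c0 xc; have t0 := le_trans s0 st.
rewrite /inv_integral primitiveB//; last by move=> *; exact: integrable_path_inv0.
have sub : `[s, t] `<=` `[0, t].
  by move=> r /=; rewrite !in_itv/= => /andP[sr ->]; rewrite (le_trans s0).
have itv : (\int[lebesgue_measure]_(r in `[s, t]) c^-1 = (t - s) / c)%R.
  rewrite Rintegral_cst//= lebesgue_measure_itv/= lte_fin mulrC.
  by case: ltgtP st => //= ->; rewrite subrr !mul0r.
rewrite -itv; apply: fine_le.
- by rewrite integral_cst//= lebesgue_measure_itv/=; case: ifPn.
- apply: integrable_fin_num => //.
  exact: integrable_path_inv.
apply: ae_ge0_le_integral => //.
- by move=> r _; rewrite lee_fin invr_ge0 ltW.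
- move=> r /sub /=; rewrite in_itv/= => /andP[r0 _].
  by rewrite lee_fin invr_ge0 (path_nonneg xp).
- apply/measurable_EFinP; apply: measurable_funS sub _ => //.
  by apply: measurable_path_inv; [exact: path_continuous|exact: path_nonneg].
exists (`[0, t] `&` x @^-1` [set 0%R]); split.
- apply: (subspace_continuous_measurable_fun _
    (path_continuousW (path_continuous xp) (lexx 0))) => //.
- rewrite -(path_zeros_null xp t0); congr (lebesgue_measure _).
- move=> r /= h; apply: contrapT => hr; apply: h => rst.
  rewrite lee_fin.
  have r0t := sub _ rst.
  move: (rst) => /=; rewrite in_itv/= => rst'.
  have xr0 : 0 <= x r by apply: (path_nonneg xp); move: rst'; lra.
  have xr : 0 < x r.
    by rewrite lt_neqAle xr0 andbT eq_sym; apply/eqP => xr; apply: hr; split.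
  by rewrite lef_pV2 ?posrE// xc.
Qed.

Lemma inv_integral_itv_le {R : realType} (x : R -> R) (s t c : R) :
  admissible_path x -> 0 <= s -> s <= t -> 0 < c ->
  (forall r, s <= r <= t -> c <= x r) ->
  inv_integral x t - inv_integral x s <= (t - s) / c.
Proof.
move=> xp s0 st c0 xc; have t0 := le_trans s0 st.
rewrite /inv_integral primitiveB//; last by move=> *; exact: integrable_path_inv0.
have sub : `[s, t] `<=` `[0, t].
  by move=> r /=; rewrite !in_itv/= => /andP[sr ->]; rewrite (le_trans s0).
have <- : (\int[lebesgue_measure]_(r in `[s, t]) c^-1 = (t - s) / c)%R.
  rewrite Rintegral_cst//= lebesgue_measure_itv/= lte_fin mulrC.
  by case: ltgtP st => //= ->; rewrite subrr !mul0r.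
apply: le_Rintegral => //.
- exact: integrable_path_inv.
- apply/integrableP; split; first exact/measurable_EFinP.
  by rewrite integral_cst//= lebesgue_measure_itv/=; case: ifPn; rewrite ltry.
- move=> r /=; rewrite in_itv/= => /xc cx.
  by rewrite lef_pV2 ?posrE// (lt_le_trans c0).
Qed.

Lemma inv_integral_nondecreasing {R : realType} (x : R -> R) (s t : R) :
  admissible_path x -> 0 <= s -> s <= t -> inv_integral x s <= inv_integral x t.
Proof.
move=> xp s0 st; rewrite -subr_ge0 /inv_integral primitiveB//; last first.
  by move=> *; exact: integrable_path_inv0.
apply: Rintegral_ge0 => r /=; rewrite in_itv/= => /andP[sr _].
by rewrite invr_ge0 (path_nonneg xp)// (le_trans s0).
Qed.

Lemma inv_integral0 {R : realType} (x : R -> R) : inv_integral x 0 = 0.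
Proof. exact: primitive0. Qed.

(** Otherwise the segment, of positive length, would lie in the null set of zeros of x. *)
Lemma admissible_path_pos_point {R : realType} (x : R -> R) (s t : R) :
  admissible_path x -> 0 <= s -> s < t -> exists2 r, s <= r <= t & 0 < x r.
Proof.
move=> xp s0 st; apply: contrapT => noroot.
have t0 := le_trans s0 (ltW st).
have : (lebesgue_measure (`[s, t] : set R) <= 0)%E.
  rewrite -(path_zeros_null xp t0); apply: le_measure; rewrite ?inE//.
    have := subspace_continuous_measurable_fun (measurable_itv _)
      (path_continuousW (path_continuous xp) (lexx 0) (t := t)).
    by move=> /(_ (measurable_itv _) [set 0])/=; exact.
  move=> r /=; rewrite in_itv/= => /andP[sr rt].
  have r0 : 0 <= r by rewrite (le_trans s0).
  split; first by rewrite in_itv/= r0.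
  apply/eqP; have := path_nonneg xp r0; rewrite le_eqVlt => /predU1P[<-//|xr].
  by exfalso; apply: noroot; exists r; rewrite ?sr.
by rewrite lebesgue_measure_itv/= lte_fin st -EFinD lee_fin leNgt subr_gt0 st.
Qed.

(** * Repulsion from the axes, and the Perron eigenvalue *)

Lemma is_solution_swap {R : realType} (alpha beta gamma delta x0 y0 : R)
    (x y : R -> R) :
  is_solution alpha beta gamma delta x0 y0 x y ->
  is_solution delta gamma beta alpha y0 x0 y x.
Proof.
by case=> xp yp ex ey; split=> // t t0; rewrite ?ex ?ey// addrAC.
Qed.

Lemma nearW_left {R : realType} (P : R -> Prop) (t : R) :
  0 < t -> (\forall s \near t, P s) ->
  exists s, [/\ 0 < s, s < t & forall r, s <= r <= t -> P r].
Proof.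
move=> t0 /nbhs_ballP[e /= e0 eP].
exists (Num.max (t / 2) (t - e / 2)); split.
- by rewrite lt_max; apply/orP; left; lra.
- by rewrite gt_max; apply/andP; split; lra.
- move=> r /andP[]; rewrite ge_max => /andP[h1 h2] h3.
  by apply: eP; rewrite /ball/= ltr_distlC; apply/andP; split; lra.
Qed.

(* Just before a zero of x at which y does not vanish, the drift
   alpha / x + beta / y of x is nonnegative, so x cannot come down to 0. *)
Lemma solution_pos_of_other {R : realType} (alpha beta gamma delta x0 y0 : R)
    (x y : R -> R) (t : R) : 0 < alpha ->
  is_solution alpha beta gamma delta x0 y0 x y -> 0 < t -> 0 < y t -> 0 < x t.
Proof.
move=> alpha0 sol t0 yt; have [xp yp ex ey] := sol.
have := path_nonneg xp (ltW t0); rewrite le_eqVlt => /predU1P[xt|//].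
(* This makes alpha / c equal to (|beta| + 1) / (y t / 2), so that while x < c and y > y t / 2 the
   repulsion alpha / x outweighs |beta| / y. *)
pose c := alpha * (y t / 2) / (`|beta| + 1).
have b1 : 0 < `|beta| + 1 by rewrite ltr_wpDl.
have c0 : 0 < c by rewrite divr_gt0// mulr_gt0// divr_gt0.
have nx : \forall s \near t, x s < c.
  have /cvgr_lt := path_continuous_at (path_continuous xp) t0.
  by apply; rewrite -xt.
have ny : \forall s \near t, y t / 2 < y s.
  have /cvgr_gt := path_continuous_at (path_continuous yp) t0.
  by apply; lra.
have [s [s0 st snear]] := nearW_left t0 (filterI nx ny).
have [r /andP[sr rt] xr] := admissible_path_pos_point xp (ltW s0) st.
have r0 : 0 <= r by rewrite (le_trans (ltW s0)).
have HA : (t - r) / c <= inv_integral x t - inv_integral x r.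
  apply: inv_integral_itv_ge => // q /andP[rq qt].
  by apply/ltW; apply: (snear q _).1; rewrite (le_trans sr).
have y20 : 0 < y t / 2 by lra.
have HB : inv_integral y t - inv_integral y r <= (t - r) / (y t / 2).
  apply: inv_integral_itv_le => // q /andP[rq qt].
  by apply/ltW; apply: (snear q _).2; rewrite (le_trans sr).
have HB0 : 0 <= inv_integral y t - inv_integral y r.
  by rewrite subr_ge0 inv_integral_nondecreasing.
apply: (lt_le_trans xr).
rewrite -subr_ge0 (ex t (ltW t0)) ex//.
set A1 := inv_integral x t in HA *; set A0 := inv_integral x r in HA *.
set B1 := inv_integral y t in HB HB0 *; set B0 := inv_integral y r in HB HB0 *.
have -> : x0 + alpha * A1 + beta * B1 - (x0 + alpha * A0 + beta * B0) =
  alpha * (A1 - A0) + beta * (B1 - B0) by ring.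
have h1 : alpha * ((t - r) / c) <= alpha * (A1 - A0) by rewrite ler_pM2l.
have h2 : - (`|beta| * ((t - r) / (y t / 2))) <= beta * (B1 - B0).
  apply: (@le_trans _ _ (- (`|beta| * (B1 - B0)))).
    by rewrite lerN2 ler_wpM2l.
  by rewrite -mulNr ler_wpM2r// lerNl ler_normr lexx orbT.
apply: (le_trans _ (lerD h1 h2)).
have -> : alpha * ((t - r) / c) = (`|beta| + 1) * ((t - r) / (y t / 2)).
  by rewrite /c; field; rewrite !gt_eqF//.
by rewrite -mulrBl addrAC subrr add0r mul1r divr_ge0 ?subr_ge0// ltW.
Qed.

(* beta + k is the Perron eigenvalue of [[beta, alpha], [delta, gamma]], with left
   eigenvector (delta, k); the other eigenpair is beta - m, (delta, - m). *)
Record perron {R : realType} (alpha beta gamma delta k m : R) : Prop := {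
  perron_k : 0 < k;
  perron_m : 0 < m;
  perron_prod : k * m = alpha * delta;
  perron_diff : k - m = gamma - beta;
  perron_eigenvalue : 0 < beta + k
}.

(** The numbers k and - m are the roots of z ^ 2 - (gamma - beta) z - alpha delta. With s the root
    of the discriminant, 2 (beta + k) = beta + gamma + s and s ^ 2 = (beta + gamma) ^ 2 + 4 (alpha
    delta - beta gamma), so a positive trace or a negative determinant gives beta + k > 0. *)
Lemma perron_exists {R : realType} (alpha beta gamma delta : R) :
  0 < alpha -> 0 < delta ->
  0 <= Num.max beta gamma \/ beta * gamma < alpha * delta ->
  exists k m, perron alpha beta gamma delta k m.
Proof.
move=> a0 d0 h.
have ad : 0 < alpha * delta by rewrite mulr_gt0.
(* If one of beta, gamma is nonnegative and their sum is not positive, then beta gamma <= 0 < alpha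
   delta. *)
have h' : 0 < beta + gamma \/ beta * gamma < alpha * delta.
  case: h => [h|]; last by right.
  case: (ltrP 0 (beta + gamma)) => [|bg]; first by left.
  by right; move: h; rewrite le_max => /orP[] ?; nra.
pose s := Num.sqrt ((gamma - beta) ^+ 2 + 4 * (alpha * delta)).
have s0 : 0 <= s by exact: sqrtr_ge0.
have s2 : s ^+ 2 = (gamma - beta) ^+ 2 + 4 * (alpha * delta).
  by rewrite sqr_sqrtr// addr_ge0 ?sqr_ge0//; lra.
have s1 : gamma - beta < s /\ beta - gamma < s by split; nra.
have s3 : - (beta + gamma) < s by case: h' => ?; nra.
exists ((gamma - beta + s) / 2), ((beta - gamma + s) / 2); split; try lra.
Qed.

(** * From the integral system to the differential equations *)

Section solution_to_ode.
Context {R : realType} (alpha beta gamma delta x0 y0 k m : R) (x y : R -> R).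
Hypothesis delta0 : 0 < delta.
Hypothesis hp : perron alpha beta gamma delta k m.
Hypothesis sol : is_solution alpha beta gamma delta x0 y0 x y.

Lemma solution_perron_coord (t : R) : 0 <= t ->
  delta * x t + k * y t = delta * x0 + k * y0 +
    (beta + k) * (k * inv_integral x t + delta * inv_integral y t).
Proof.
move=> t0; have [_ _ ex ey] := sol; rewrite ex// ey//.
case: hp => k0 m0 km kmd _.
have -> : gamma = k - m + beta by lra.
set A := inv_integral x t; set B := inv_integral y t.
have : alpha * delta * A = k * m * A by rewrite km.
lra.
Qed.

(** The form delta x + k y is nondecreasing in time by [solution_perron_coord], and it is positive
    at some time in [0, t] at which x is positive. *)
Lemma solution_not_origin (t : R) : 0 < t -> 0 < x t \/ 0 < y t.
Proof.
move=> t0; have [xp yp _ _] := sol; have [k0 m0 _ _ lam0] := hp.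
have [r /andP[r0 rt] xr] := admissible_path_pos_point xp (lexx 0) t0.
have yr := path_nonneg yp r0.
have xt := path_nonneg xp (ltW t0); have yt := path_nonneg yp (ltW t0).
have dA := inv_integral_nondecreasing xp r0 rt.
have dB := inv_integral_nondecreasing yp r0 rt.
have vrt : delta * x r + k * y r <= delta * x t + k * y t.
  rewrite (solution_perron_coord (ltW t0)) solution_perron_coord//.
  by rewrite lerD2l ler_pM2l// lerD// ler_pM2l.
have vr : 0 < delta * x r + k * y r.
  by rewrite ltr_pwDl ?mulr_gt0// mulr_ge0// ltW.
have := lt_le_trans vr vrt.
have [xt0|] := ltP 0 (x t); first by left.
move=> xt0; have -> : x t = 0 by apply/le_anti; rewrite xt xt0.
by rewrite mulr0 add0r pmulr_rgt0//; right.
Qed.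

End solution_to_ode.

(** The common shape of the affine combinations differentiated below; explicit coefficients 0 and 1
    there serve to match it. *)
Lemma is_derive_affine2 {R : realType} (c a b : R) (f g : R -> R) (t df dg : R) :
  is_derive t 1 f df -> is_derive t 1 g dg ->
  is_derive t 1 (fun s => c + a * f s + b * g s) (a * df + b * dg).
Proof.
move=> Df Dg.
have D := is_deriveD (is_deriveD (is_derive_cst c t 1) (is_deriveZ a Df))
  (is_deriveZ b Dg).
rewrite add0r in D.
exact: D.
Qed.
Lemma is_derive_mul {R : realType} (f g : R -> R) (t df dg : R) :
  is_derive t 1 f df -> is_derive t 1 g dg ->
  is_derive t 1 (fun s => f s * g s) (f t * dg + df * g t).
Proof.
move=> Df Dg; have D := is_deriveM Df Dg.
rewrite (_ : f t * dg + df * g t = f t *: dg + g t *: df) //.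
by congr (_ + _); exact: mulrC.
Qed.
Lemma is_derive_compose {R : realType} (f g : R -> R) (t df dg : R) :
  is_derive (g t) 1 f df -> is_derive t 1 g dg ->
  is_derive t 1 (fun s => f (g s)) (df * dg).
Proof. exact: is_derive1_comp. Qed.

(** The equations and positivity are imposed at positive times only: a start on an axis makes the
    right-hand sides singular at 0, and the initial values enter through continuity. *)
Record ode_solution {R : realType} (alpha beta gamma delta x0 y0 : R)
    (x y : R -> R) : Prop := {
  ode_x_init : x 0 = x0;
  ode_y_init : y 0 = y0;
  ode_x_continuous : continuous_on_halfline x;
  ode_y_continuous : continuous_on_halfline y;
  ode_x_pos : forall t : R, 0 < t -> 0 < x t;
  ode_y_pos : forall t : R, 0 < t -> 0 < y t;
  ode_x_derive : forall t : R, 0 < t -> is_derive t 1 x (alpha / x t + beta / y t);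
  ode_y_derive : forall t : R, 0 < t -> is_derive t 1 y (gamma / x t + delta / y t)
}.

Lemma inv_integral_is_derive {R : realType} (x : R -> R) (t : R) :
  admissible_path x -> 0 < t -> 0 < x t ->
  is_derive t 1 (inv_integral x) (x t)^-1.
Proof.
move=> xp t0 xt; apply: (@primitive_is_derive _ (fun s => (x s)^-1)) => //.
  by move=> *; exact: integrable_path_inv0.
apply: continuousV; first by rewrite gt_eqF.
exact: path_continuous_at (path_continuous xp) t0.
Qed.

Lemma solution_is_derive {R : realType} (a b z0 : R) (x y z : R -> R) (t : R) :
  admissible_path x -> admissible_path y ->
  (forall s : R, 0 <= s -> z s = z0 + a * inv_integral x s + b * inv_integral y s) ->
  0 < t -> 0 < x t -> 0 < y t -> is_derive t 1 z (a / x t + b / y t).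
Proof.
move=> xp yp ez t0 xt yt.
have dA := inv_integral_is_derive xp t0 xt.
have dB := inv_integral_is_derive yp t0 yt.
apply: near_eq_is_derive (is_derive_affine2 z0 a b dA dB).
by near=> s; rewrite ez// ltW//; near: s; exact: lt_nbhsr.
Unshelve. all: by end_near. Qed.

(** One coordinate is positive because the solution is not at the origin; the repulsion then makes
    the other positive, after a swap if necessary. Both integrands are thus continuous at t > 0 and
    the integral equations can be differentiated. *)
Lemma solution_ode {R : realType} (alpha beta gamma delta x0 y0 k m : R)
    (x y : R -> R) : 0 < alpha -> 0 < delta ->
  perron alpha beta gamma delta k m ->
  is_solution alpha beta gamma delta x0 y0 x y ->
  ode_solution alpha beta gamma delta x0 y0 x y.
Proof.
move=> alpha0 delta0 hp sol; have [xp yp ex ey] := sol.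
have pos (t : R) : 0 < t -> 0 < x t /\ 0 < y t.
  move=> t0; have [xt|yt] := solution_not_origin delta0 hp sol t0.
    by split => //; exact: solution_pos_of_other delta0 (is_solution_swap sol) t0 xt.
  by split => //; exact: solution_pos_of_other alpha0 sol t0 yt.
split.
- by rewrite ex// !inv_integral0 !mulr0 !addr0.
- by rewrite ey// !inv_integral0 !mulr0 !addr0.
- exact: path_continuous xp.
- exact: path_continuous yp.
- by move=> t /pos[].
- by move=> t /pos[].
- by move=> t t0; have [xt yt] := pos t t0; exact: solution_is_derive xp yp ex t0 xt yt.
- by move=> t t0; have [xt yt] := pos t t0; exact: solution_is_derive xp yp ey t0 xt yt.
Qed.

(** * From the differential equations to the integral system *)

Lemma halfline_derive_ge0_le {R : realType} (f df : R -> R) (t : R) :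
  continuous_on_halfline f -> (forall s : R, 0 < s -> is_derive s 1 f (df s)) ->
  (forall s : R, 0 < s -> 0 <= df s) -> 0 <= t -> f 0 <= f t.
Proof.
move=> cf dF df0; rewrite le_eqVlt => /predU1P[<-//|t0].
have dft (s : R) : s \in `]0, t[ -> is_derive s 1 f (df s).
  by rewrite in_itv/= => /andP[s0 _]; exact: dF.
have [c + E] := MVT t0 dft (path_continuousW (t := t) cf (lexx 0)).
rewrite in_itv/= => /andP[c0 _].
by rewrite -subr_ge0 E mulr_ge0 ?df0// subr0 ltW.
Qed.

(** Since f may blow up at 0, the fundamental theorem is applied on the segments [t / (n + 1), t],
    which exhaust ]0, t]. There the integral of g is at most the increment of F, hence at most F t -
    F 0 because F is at least F 0; monotone convergence concludes. *)
Lemma ge0_integral_le_primitive {R : realType} (g f F : R -> R) (t : R) :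
  0 < t -> measurable_fun `[0, t] g -> (forall s : R, 0 <= s -> 0 <= g s) ->
  (forall s : R, 0 < s -> g s <= f s) ->
  (forall s : R, 0 < s -> {for s, continuous f}) ->
  continuous_on_halfline F ->
  (forall s : R, 0 < s -> is_derive s 1 F (f s)) ->
  (\int[lebesgue_measure]_(s in `[0%R, t]) (g s)%:E <= (F t - F 0)%:E)%E.
Proof.
move=> t0 mg g0 gf cf cF dF.
have F0 (s : R) : 0 <= s -> F 0 <= F s.
  apply: (halfline_derive_ge0_le cF dF) => r r0.
  by rewrite (le_trans (g0 _ (ltW r0)))// gf.
pose E n : set R := [set` `[n.+1%:R^-1 * t, t]].
have En0 n (s : R) : E n s -> 0 < s.
  rewrite /E/= in_itv/= => /andP[+ _]; apply: lt_le_trans.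
  by rewrite mulr_gt0 ?invr_gt0.
have mgoc : measurable_fun `]0, t] g.
  apply: measurable_funS mg => // r /=.
  by rewrite !in_itv/= => /andP[/ltW -> ->].
rewrite -integral_itv_obnd_cbnd; last exact/measurable_EFinP.
have UE : `]0, t]%classic = \bigcup_n E n.
  apply/seteqP; split=> [r /=|r [n _] Enr].
    rewrite in_itv/= => /andP[r0 rt].
    have rt1 : 0 < r / t by rewrite divr_gt0.
    have [n nP] := ltr_add_invr (y := 0) (x := r / t) rt1.
    exists n => //; rewrite /E/= in_itv/= rt andbT -ler_pdivlMr//.
    by move: nP; rewrite add0r => /ltW.
  by rewrite /= in_itv/= (En0 _ _ Enr); move: Enr; rewrite /E/= in_itv/= => /andP[].
have Esub n : E n `<=` `]0, t]%classic by move=> r Enr; rewrite UE; exists n.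
have mgE n : measurable_fun (E n) (EFin \o g).
  by apply/measurable_EFinP; apply: measurable_funS mgoc.
have g0E n s : E n s -> (0 <= (EFin \o g) s)%E.
  by move=> /En0/ltW s0; rewrite lee_fin g0.
have ndE : nondecreasing_seq E.
  apply/nondecreasing_seqP => n; apply/subsetPset => r.
  rewrite /E/= !in_itv/= => /andP[nr ->]; rewrite andbT (le_trans _ nr)//.
  by rewrite ler_pM2r// lef_pV2 ?posrE// ler_nat.
have mE n : measurable (E n) by exact: measurable_itv.
have := @ge0_nondecreasing_set_cvg_integral _ (measurableTypeR R) R E
  (EFin \o g) lebesgue_measure  ndE mE mgE g0E.
move=> /cvg_lim; rewrite -UE => <-//.
apply: lime_le.
  apply: ereal_nondecreasing_is_cvgn.
  exact: ge0_nondecreasing_set_nondecreasing_integral.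
apply: nearW => n.
have a0 : 0 < n.+1%:R^-1 * t by rewrite mulr_gt0 ?invr_gt0.
have : n.+1%:R^-1 * t <= t.
  by rewrite ler_piMl ?(ltW t0)// invf_le1// ler1n.
(* For n = 0 the segment is the single point t, to which the fundamental theorem does not apply. *)
rewrite le_eqVlt => /predU1P[at_|at_].
  by rewrite /E at_ set_itv1 integral_set1 lee_fin subr_ge0 F0// ltW.
have cfE : {within E n, continuous f}.
  apply: continuous_in_subspaceT => r; rewrite inE => /En0; exact: cf.
apply: (@le_trans _ _ (\int[lebesgue_measure]_(s in E n) (f s)%:E)%E).
  apply: ge0_le_integral.
  - exact: mE.
  - by move=> r; exact: g0E.
  - exact: mgE.
  - by apply/measurable_EFinP; exact: subspace_continuous_measurable_fun.
  - by move=> r rE; rewrite lee_fin gf//; exact: En0 rE.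
rewrite (@continuous_FTC2 _ f F _ _ at_)//.
- by rewrite -EFinB lee_fin lerD2l lerN2 F0// ltW.
- have /(continuous_within_itvP _ at_)[Fi Fa Ft] := path_continuousW (t := t) cF (ltW a0).
  split => // r; rewrite in_itv/= => /andP[ar _].
  by have [] := dF r (lt_trans a0 ar).
- move=> r; rewrite in_itv/= => /andP[ar _].
  have dFr := dF r (lt_trans a0 ar).
  by rewrite derive1E derive_val.
Qed.

Lemma halfline_derive0_cst {R : realType} (f : R -> R) (t : R) :
  continuous_on_halfline f -> (forall s : R, 0 < s -> is_derive s 1 f 0) ->
  0 <= t -> f t = f 0.
Proof.
move=> cf df t0; apply/eqP; rewrite -subr_eq0; apply/eqP.
have dft (s : R) : s \in `]0, t[ -> is_derive s 1 f (cst 0 s).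
  by rewrite in_itv/= => /andP[s0 _]; exact: df.
have [c _ ->] := MVT_segment t0 dft (path_continuousW (t := t) cf (lexx 0)).
by rewrite mul0r.
Qed.

(** No continuity at 0 is asked for: from the origin, the clock ln v / l1 tends to -oo at time 0. *)
Lemma positive_derive0_cst {R : realType} (f : R -> R) (s t : R) :
  (forall r : R, 0 < r -> is_derive r 1 f 0) -> 0 < s -> s < t -> f t = f s.
Proof.
move=> df s0 st; apply/eqP; rewrite -subr_eq0; apply/eqP.
have dft (r : R) : r \in `]s, t[ -> is_derive r 1 f (cst 0 r).
  by rewrite in_itv/= => /andP[sr _]; apply: df; exact: lt_trans sr.
have [|c _ ->] := MVT st dft; last by rewrite mul0r.
apply: derivable_within_continuous => r; rewrite in_itv/= => /andP[sr _].
by have [] := df r (lt_le_trans s0 sr).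
Qed.

Lemma continuous_on_halfline_affine2 {R : realType} (c a b : R) (f g : R -> R) :
  continuous_on_halfline f -> continuous_on_halfline g ->
  continuous_on_halfline (fun s => c + a * f s + b * g s).
Proof.
move=> cf cg s; apply: cvgD; last by apply: cvgM; [exact: cvg_cst|exact: cg].
by apply: cvgD; [exact: cvg_cst|apply: cvgM; [exact: cvg_cst|exact: cf]].
Qed.

(** Positivity confines the zeros of z to the point 0, and the integral of 1 / z up to t is
    dominated by F t - F 0. *)
Lemma admissible_path_of_primitive {R : realType} (z f F : R -> R) : continuous_on_halfline z ->
  0 <= z 0 -> (forall s : R, 0 < s -> 0 < z s) ->
  (forall s : R, 0 < s -> (z s)^-1 <= f s) ->
  (forall s : R, 0 < s -> {for s, continuous f}) ->
  continuous_on_halfline F ->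
  (forall s : R, 0 < s -> is_derive s 1 F (f s)) ->
  admissible_path z.
Proof.
move=> cz z0 zp zf cf cF dF.
have znn s : 0 <= s -> 0 <= z s.
  by rewrite le_eqVlt => /predU1P[<-//|/zp/ltW].
split => // t t0.
  have [zz|zz] := eqVneq (z 0) 0.
    rewrite (_ : [set s | _] = [set 0]) ?lebesgue_measure_set1//.
    apply/seteqP; split=> s /=; last by move=> ->; rewrite in_itv/= lexx t0.
    rewrite in_itv/= => -[/andP[+ _] zs]; rewrite le_eqVlt => /predU1P[//|/zp].
    by rewrite zs ltxx.
  rewrite (_ : [set s | _] = set0) ?measure0//.
  apply/seteqP; split=> s //=.
  rewrite in_itv/= => -[/andP[+ _] zs]; rewrite le_eqVlt => /predU1P[s0|/zp].
    by move: zs zz; rewrite -s0 => ->; rewrite eqxx.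
  by rewrite zs ltxx.
move: t0; rewrite le_eqVlt => /predU1P[<-|t0].
  by rewrite set_itv1 integral_set1.
apply: (@le_lt_trans _ _ (F t - F 0)%:E); last exact: ltry.
apply: le_trans (ge0_integral_le_primitive t0 _ _ zf cf cF dF); last 2 first.
- exact: measurable_path_inv.
- by move=> s s0; rewrite invr_ge0 znn.
rewrite le_eqVlt; apply/orP; left; apply/eqP.
apply: eq_integral => s; rewrite inE/= in_itv/= => /andP[+ _].
rewrite le_eqVlt indicE => /predU1P[<-|s0].
  have [->|zz] := eqVneq (z 0) 0; first by rewrite invr0 mulr0.
  by rewrite mem_set/= ?mul1r// lt_neqAle eq_sym zz.
by rewrite mem_set/= ?mul1r// zp.
Qed.

Section ode_is_solution.
Context {R : realType} (alpha beta gamma delta x0 y0 k m : R) (x y : R -> R).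
Hypothesis delta0 : 0 < delta.
Hypotheses (x00 : 0 <= x0) (y00 : 0 <= y0).
Hypothesis hp : perron alpha beta gamma delta k m.
Hypothesis ode : ode_solution alpha beta gamma delta x0 y0 x y.

(** The free factor c adapts the derivative of v to either coordinate: c = 1 / (l1 k) makes it
    dominate 1 / x, and c = 1 / (l1 delta) makes it dominate 1 / y. A multiple of v is thus the
    primitive that bounds each integral. *)
Let drift_perron (s : R) (c : R) : 0 < s ->
  is_derive s 1 (fun s => 0 + (c * delta) * x s + (c * k) * y s)
    (c * (beta + k) * (k / x s + delta / y s)).
Proof.
move=> s0; have [_ _ _ _ xp yp dx dy] := ode; have [_ _ km kmd _] := hp.
have D := is_derive_affine2 0 (c * delta) (c * k) (dx s s0) (dy s s0).
rewrite (_ : c * (beta + k) * _ = c * delta * (alpha / x s + beta / y s) +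
  c * k * (gamma / x s + delta / y s)) //.
have -> : gamma = beta + k - m by lra.
have : c * (k * m) / x s = c * (alpha * delta) / x s by rewrite km.
move: (x s)^-1 (y s)^-1 => X Y; lra.
Qed.

Lemma ode_is_solution : is_solution alpha beta gamma delta x0 y0 x y.
Proof.
have [x_0 y_0 cx cy xp yp dx dy] := ode; have [k0 m0 km kmd lam0] := hp.
have cV c := @continuous_on_halfline_affine2 R 0 (c * delta) (c * k) x y cx cy.
have cinv (z : R -> R) (s : R) : continuous_on_halfline z -> 0 < s -> 0 < z s ->
    {for s, continuous (fun s => (z s)^-1)}.
  by move=> cz s0 zs; apply: continuousV;
    [rewrite gt_eqF|exact: path_continuous_at].
have cf c (s : R) : 0 < s ->
    {for s, continuous (fun s => c * (beta + k) * (k / x s + delta / y s))}.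
  move=> s0; apply: cvgM; first exact: cvg_cst.
  apply: cvgD; apply: cvgM; (try exact: cvg_cst).
  - by apply: cinv => //; exact: xp.
  - by apply: cinv => //; exact: yp.
have xa : admissible_path x.
  apply: (admissible_path_of_primitive cx _ xp _ (cf _) (cV _) _); first by rewrite x_0.
    2: by move=> s s0; exact: (drift_perron ((beta + k) * k)^-1 s0).
  move=> s s0 /=.
  have -> : ((beta + k) * k)^-1 * (beta + k) = k^-1.
    by field; rewrite !gt_eqF.
  rewrite mulrDr mulrA mulVf ?gt_eqF// mul1r lerDl.
  by rewrite !mulr_ge0// ?invr_ge0 ltW// yp.
have ya : admissible_path y.
  apply: (admissible_path_of_primitive cy _ yp _ (cf _) (cV _) _); first by rewrite y_0.
    2: by move=> s s0; exact: (drift_perron ((beta + k) * delta)^-1 s0).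
  move=> s s0 /=.
  have -> : ((beta + k) * delta)^-1 * (beta + k) = delta^-1.
    by field; rewrite !gt_eqF.
  rewrite mulrDr addrC mulrA mulVf ?gt_eqF// mul1r lerDl.
  by rewrite !mulr_ge0// ?invr_ge0 ltW// xp.
have cI (z : R -> R) : admissible_path z -> continuous_on_halfline (inv_integral z).
  by move=> za; apply: primitive_continuous => t t0; exact: integrable_path_inv0.
(* The path and its integral expression have the same derivative at positive times and agree at
   0. *)
have eq (z : R -> R) (a b : R) : continuous_on_halfline z ->
    (forall s : R, 0 < s -> is_derive s 1 z (a / x s + b / y s)) ->
    forall t : R, 0 <= t -> z t = z 0 + a * inv_integral x t + b * inv_integral y t.
  move=> cz dz t t0.
  pose I s := 0 + a * inv_integral x s + b * inv_integral y s.
  have cE : continuous_on_halfline (fun s => 0 + 1 * z s + (-1) * I s).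
    by do !apply: continuous_on_halfline_affine2 => //; exact: cI.
  have dE (s : R) : 0 < s -> is_derive s 1 (fun s => 0 + 1 * z s + (-1) * I s) 0.
    move=> s0; have := is_derive_affine2 0 1 (-1) (dz s s0)
      (is_derive_affine2 0 a b (inv_integral_is_derive xa s0 (xp s s0))
         (inv_integral_is_derive ya s0 (yp s s0))).
    by rewrite mul1r mulN1r subrr.
  by have := halfline_derive0_cst cE dE t0; rewrite /I !inv_integral0; lra.
split => // t t0.
- by rewrite (eq x alpha beta)// x_0.
- by rewrite (eq y gamma delta)// y_0.
Qed.

End ode_is_solution.

(** * The linear flow and its clock *)

Lemma is_derive_expRM {R : realType} (a u : R) :
  is_derive u 1 (fun r => expR (a * r)) (a * expR (a * u)).
Proof.
have D := is_derive_compose (is_derive_expR (a * u)) (is_deriveZ a (is_derive_id u 1)).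
by rewrite mulrC; move: D; rewrite [_ *: _]mulr1.
Qed.

(** The case a = 0 matters: the clock of the flow uses the exponents l1 + l2 and 2 l2, which may
    vanish. *)
Lemma expR_primitive {R : realType} (a : R) :
  exists2 E : R -> R, E 0 = 0 & forall u : R, is_derive u 1 E (expR (a * u)).
Proof.
have [->|a0] := eqVneq a 0.
  by exists id => // u; rewrite mul0r expR0; exact: is_derive_id.
exists (fun u => - a^-1 + a^-1 * expR (a * u) + 0 * u) => [|u].
  by rewrite mulr0 expR0; lra.
have D := is_derive_affine2 (- a^-1) a^-1 0 (is_derive_expRM a u) (is_derive_id u 1).
by rewrite mul0r addr0 mulrA mulVf// mul1r in D.
Qed.

Lemma derivable_everywhere_continuous {R : realType} (f df : R -> R) :
  (forall u : R, is_derive u 1 f (df u)) -> continuous f.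
Proof.
move=> dF u; apply/differentiable_continuous/derivable1_diffP.
by have [] := dF u.
Qed.

Section perron_flow.
Context {R : realType} (l1 l2 k m delta v0 w0 : R).
Hypotheses (l21 : l2 < l1) (l10 : 0 < l1) (k0 : 0 < k) (m0 : 0 < m).
Hypotheses (delta0 : 0 < delta) (v00 : 0 < v0).
(** In the original coordinates, v0 - w0 = (k + m) y0 and m v0 + k w0 = (k + m) delta x0. *)
Hypotheses (y0_ge0 : w0 <= v0) (x0_ge0 : 0 <= m * v0 + k * w0).

(* The linear flow with eigenvalues l1, l2 started from the eigencoordinates
   v0 = delta x0 + k y0 and w0 = delta x0 - m y0. *)
Definition flow_x (u : R) :=
  (m * v0 * expR (l1 * u) + k * w0 * expR (l2 * u)) / (delta * (k + m)).
Definition flow_y (u : R) :=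
  (v0 * expR (l1 * u) - w0 * expR (l2 * u)) / (k + m).

(** Factor out exp (l1 u) >= 1; with q = exp ((l2 - l1) u) in [0, 1], what remains is a (1 - q) + (a
    + b) q. *)
Lemma flow_lower (a b : R) (u : R) : 0 <= a -> - a <= b -> 0 <= u ->
  a * (1 - expR ((l2 - l1) * u)) <= a * expR (l1 * u) + b * expR (l2 * u).
Proof.
move=> a0 ab u0.
have e1 : 1 <= expR (l1 * u) by rewrite -expR0 ler_expR mulr_ge0// ltW.
have -> : l2 * u = (l2 - l1) * u + l1 * u by ring.
rewrite expRD; set q := expR ((l2 - l1) * u); set e := expR (l1 * u) in e1 *.
have q0 : 0 <= q by exact: expR_ge0.
have q1 : q <= 1.
  by rewrite -expR0 ler_expR mulr_le0_ge0// subr_le0 ltW.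
have -> : a * e + b * (q * e) = e * (a * (1 - q) + (b + a) * q) by ring.
have h : 0 <= a * (1 - q) by rewrite mulr_ge0// subr_ge0.
have h2 : 0 <= (b + a) * q by apply: mulr_ge0 => //; lra.
have h3 : a * (1 - q) <= a * (1 - q) + (b + a) * q by lra.
apply: (le_trans h3); rewrite ler_peMl//; lra.
Qed.

Lemma flow_x_lower (u : R) : 0 <= u ->
  m * v0 / (delta * (k + m)) * (1 - expR ((l2 - l1) * u)) <= flow_x u.
Proof.
move=> u0; rewrite mulrAC ler_pM2r ?invr_gt0 ?mulr_gt0 ?addr_gt0//.
apply: flow_lower => //; first by rewrite mulr_ge0// ltW.
by rewrite -subr_ge0 opprK addrC.
Qed.

Lemma flow_y_lower (u : R) : 0 <= u ->
  v0 / (k + m) * (1 - expR ((l2 - l1) * u)) <= flow_y u.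
Proof.
move=> u0; rewrite mulrAC ler_pM2r ?invr_gt0 ?mulr_gt0 ?addr_gt0//.
rewrite -mulNr; apply: flow_lower => //; first exact: ltW.
by rewrite lerN2.
Qed.

Lemma flow_gap_gt0 (u : R) : 0 < u -> 0 < 1 - expR ((l2 - l1) * u).
Proof.
by move=> u0; rewrite subr_gt0 -[ltRHS]expR0 ltr_expR pmulr_llt0// subr_lt0.
Qed.

Lemma flow_x_gt0 (u : R) : 0 < u -> 0 < flow_x u.
Proof.
move=> u0; apply: lt_le_trans (flow_x_lower (ltW u0)).
by rewrite mulr_gt0 ?flow_gap_gt0// divr_gt0 ?mulr_gt0 ?addr_gt0.
Qed.

Lemma flow_y_gt0 (u : R) : 0 < u -> 0 < flow_y u.
Proof.
move=> u0; apply: lt_le_trans (flow_y_lower (ltW u0)).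
by rewrite mulr_gt0 ?flow_gap_gt0// divr_gt0 ?addr_gt0.
Qed.

(** T is the original time as a function of the new time u. The product X Y expands into
    exponentials with exponents 2 l1, l1 + l2 and 2 l2, each integrated from 0. *)
Lemma flow_clock : exists2 T : R -> R,
  T 0 = 0 & forall u : R, is_derive u 1 T (flow_x u * flow_y u).
Proof.
have [E1 E10 dE1] := expR_primitive (l1 + l1).
have [E2 E20 dE2] := expR_primitive (l1 + l2).
have [E3 E30 dE3] := expR_primitive (l2 + l2).
pose d := (delta * (k + m) ^+ 2)^-1.
exists (fun u => 0 + (m * v0 ^+ 2 * d) * E1 u + 1 *
  (0 + ((k - m) * v0 * w0 * d) * E2 u + (- (k * w0 ^+ 2 * d)) * E3 u)) => [|u].
  by rewrite E10 E20 E30; lra.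
have := is_derive_affine2 0 (m * v0 ^+ 2 * d) 1 (dE1 u)
  (is_derive_affine2 0 ((k - m) * v0 * w0 * d) (- (k * w0 ^+ 2 * d)) (dE2 u) (dE3 u)).
congr is_derive; rewrite /flow_x /flow_y !mulrDl !expRD /d.
by field; rewrite !gt_eqF// addr_gt0.
Qed.

(** The speed X Y may vanish at 0, for a start on an axis, but the mean value theorem evaluates it
    at an interior, hence positive, point. *)
Lemma flow_clock_incr (T : R -> R) :
  (forall u : R, is_derive u 1 T (flow_x u * flow_y u)) ->
  forall r s : R, 0 <= r -> r < s -> T r < T s.
Proof.
move=> dT r s r0 rs; rewrite -subr_gt0.
have [c + ->] := MVT rs (fun u _ => dT u)
  (continuous_subspaceT (derivable_everywhere_continuous dT)).
rewrite in_itv/= => /andP[rc _]; have c0 : 0 < c by exact: le_lt_trans rc.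
by rewrite mulr_gt0 ?subr_gt0// mulr_gt0 ?flow_x_gt0 ?flow_y_gt0.
Qed.

Lemma flow_clock_inj (T : R -> R) :
  (forall u : R, is_derive u 1 T (flow_x u * flow_y u)) ->
  forall r s : R, 0 <= r -> 0 <= s -> T r = T s -> r = s.
Proof.
move=> dT r s r0 s0 Trs; have := flow_clock_incr dT.
by case: (ltgtP r s) => // + incr => /incr; [move/(_ r0)|move/(_ s0)]; rewrite Trs ltxx.
Qed.

(** Beyond u = 1 both coordinates of the flow stay above positive constants, so T grows at least
    linearly and the intermediate value theorem applies. *)
Lemma flow_clock_surj (T : R -> R) : T 0 = 0 ->
  (forall u : R, is_derive u 1 T (flow_x u * flow_y u)) ->
  forall t : R, 0 <= t -> exists2 u, 0 <= u & T u = t.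
Proof.
move=> T0 dT t t0; have cT := derivable_everywhere_continuous dT.
pose g := 1 - expR ((l2 - l1) * 1).
have g0 : 0 < g by exact: flow_gap_gt0.
pose c := (m * v0 / (delta * (k + m)) * g) * (v0 / (k + m) * g).
have c1 : 0 < m * v0 / (delta * (k + m)) * g.
  by rewrite mulr_gt0// divr_gt0 ?mulr_gt0 ?addr_gt0.
have c2 : 0 < v0 / (k + m) * g by rewrite mulr_gt0// divr_gt0 ?addr_gt0.
have c0 : 0 < c by rewrite mulr_gt0.
(* T 1 is positive and T has slope at least c after 1, so T u1 is at least c (t / c) = t. *)
pose u1 := 1 + t / c.
have tc : 0 <= t / c by rewrite divr_ge0// ltW.
have u10 : 0 <= u1 by rewrite /u1; lra.
have Tu1 : t <= T u1.
  have T1 : 0 < T 1 by rewrite -T0; apply: (flow_clock_incr dT).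
  have [|b] := @MVT_segment R T _ 1 u1 _ (fun u _ => dT u) (continuous_subspaceT cT).
    by rewrite /u1; lra.
  rewrite in_itv/= => /andP[b1 _] Tb.
  have b0 : 0 <= b by lra.
  have gb : g <= 1 - expR ((l2 - l1) * b).
    by rewrite lerD2l lerN2 ler_expR ler_nM2l// subr_lt0.
  have : t <= flow_x b * flow_y b * (u1 - 1).
    rewrite [u1 - 1](_ : _ = t / c); last by rewrite /u1; ring.
    rewrite mulrCA ler_peMr// ler_pdivlMr// mul1r.
    apply: ler_pM; [exact: ltW|exact: ltW| |].
      apply: le_trans (flow_x_lower b0).
      by rewrite ler_pM2l// divr_gt0 ?mulr_gt0 ?addr_gt0.
    by apply: le_trans (flow_y_lower b0); rewrite ler_pM2l// divr_gt0 ?addr_gt0.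
  by rewrite -Tb; lra.
have [|u] := @IVT R T 0 u1 t u10 (continuous_subspaceT cT).
  by rewrite T0 min_l ?max_r ?t0 ?(le_trans t0).
by rewrite in_itv/= => /andP[u0 _] Tu; exists u.
Qed.

End perron_flow.

(** * Trajectories in eigencoordinates *)

Lemma continuous_on_halfline_comp {R : realType} (f g : R -> R) :
  continuous_on_halfline g ->
  (forall t : R, 0 <= t -> {for g t, continuous f}) ->
  continuous_on_halfline (fun t => f (g t)).
Proof.
move=> /continuous_within_itvcyP[cg cg0] cf; apply/continuous_within_itvcyP.
split=> [t t0|]; last exact: continuous_cvg (cf 0 (lexx 0)) cg0.
apply: continuous_comp; first exact: cg.
by apply: cf; move: t0; rewrite in_itv/= andbT => /ltW.
Qed.

Lemma continuous_on_halfline_mul {R : realType} (f g : R -> R) :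
  continuous_on_halfline f -> continuous_on_halfline g ->
  continuous_on_halfline (fun t => f t * g t).
Proof. by move=> cf cg s; apply: cvgM; [exact: cf|exact: cg]. Qed.

Lemma continuous_on_halfline_id {R : realType} :
  continuous_on_halfline (fun t : R => t).
Proof. by apply: continuous_subspaceT => ?; exact: cvg_id. Qed.

Section ode_perron_coordinates.
Context {R : realType} (alpha beta gamma delta x0 y0 k m : R) (x y : R -> R).
Hypothesis delta0 : 0 < delta.
Hypothesis hp : perron alpha beta gamma delta k m.
Hypothesis ode : ode_solution alpha beta gamma delta x0 y0 x y.

(** The eigencoordinate v for b = k, and w for b = - m. *)
Definition perron_coord (b : R) (t : R) := 0 + delta * x t + b * y t.

Lemma perron_coord_continuous (b : R) : continuous_on_halfline (perron_coord b).
Proof.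
by apply: continuous_on_halfline_affine2;
  [exact: ode_x_continuous ode|exact: ode_y_continuous ode].
Qed.

Lemma perron_coord_derive1 (t : R) : 0 < t ->
  is_derive t 1 (perron_coord k) ((beta + k) * perron_coord k t / (x t * y t)).
Proof.
move=> t0; have [_ _ _ _ xp yp dx dy] := ode; have [_ _ km kmd _] := hp.
have := is_derive_affine2 0 delta k (dx t t0) (dy t t0); congr is_derive.
have -> : gamma = beta + k - m by lra.
have := xp t t0; have := yp t t0; rewrite /perron_coord => yt xt.
(* Isolates the product k m, to be replaced by alpha delta. *)
have -> : k * ((beta + k - m) / x t + delta / y t) =
  k * (beta + k) / x t - (k * m) / x t + k * delta / y t by ring.
by rewrite km; field; rewrite !gt_eqF.
Qed.

Lemma perron_coord_derive2 (t : R) : 0 < t ->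
  is_derive t 1 (perron_coord (- m))
    ((beta - m) * perron_coord (- m) t / (x t * y t)).
Proof.
move=> t0; have [_ _ _ _ xp yp dx dy] := ode; have [_ _ km kmd _] := hp.
have := is_derive_affine2 0 delta (- m) (dx t t0) (dy t t0); congr is_derive.
have -> : gamma = beta + k - m by lra.
have := xp t t0; have := yp t t0; rewrite /perron_coord => yt xt.
have -> : - m * ((beta + k - m) / x t + delta / y t) =
  - m * (beta - m) / x t - (k * m) / x t - m * delta / y t by ring.
by rewrite km; field; rewrite !gt_eqF.
Qed.

Lemma perron_coord_gt0 (t : R) : 0 < t -> 0 < perron_coord k t.
Proof.
move=> t0; have [k0 _ _ _ _] := hp.
rewrite /perron_coord add0r addr_gt0// mulr_gt0//.
- exact: ode_x_pos ode _ t0.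
- exact: ode_y_pos ode _ t0.
Qed.

Lemma perron_coord_x (t : R) : x t =
  (m * perron_coord k t + k * perron_coord (- m) t) / (delta * (k + m)).
Proof.
have [k0 m0 _ _ _] := hp; rewrite /perron_coord; field.
by rewrite !gt_eqF// addr_gt0.
Qed.

Lemma perron_coord_y (t : R) :
  y t = (perron_coord k t - perron_coord (- m) t) / (k + m).
Proof.
have [k0 m0 _ _ _] := hp; rewrite /perron_coord; field.
by rewrite !gt_eqF// addr_gt0.
Qed.

Lemma perron_clock_derive (t : R) : 0 < t ->
  is_derive t 1 (fun s => (beta + k)^-1 * ln (perron_coord k s)) (x t * y t)^-1.
Proof.
move=> t0; have [_ _ _ _ lam0] := hp; have vt := perron_coord_gt0 t0.
have D := is_deriveZ (beta + k)^-1
  (is_derive_compose (is_derive1_ln vt) (perron_coord_derive1 t0)).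
have xt := ode_x_pos ode t0; have yt := ode_y_pos ode t0.
move: D; congr is_derive; rewrite /GRing.scale/=; field.
by rewrite !gt_eqF.
Qed.

End ode_perron_coordinates.

(** * Starting points other than the origin *)

Section ode_from_nonorigin.
Context {R : realType} (alpha beta gamma delta x0 y0 k m : R).
Hypothesis delta0 : 0 < delta.
Hypothesis hp : perron alpha beta gamma delta k m.
Let v0 := delta * x0 + k * y0.
Let w0 := delta * x0 - m * y0.
Hypothesis v00 : 0 < v0.
Local Notation X := (flow_x (beta + k) (beta - m) k m delta v0 w0).
Local Notation Y := (flow_y (beta + k) (beta - m) k m v0 w0).
Variable T : R -> R.
Hypothesis T0 : T 0 = 0.
Hypothesis dT : forall u : R, is_derive u 1 T (X u * Y u).

(** The function L is the time change read off from v, so v is exponential in L by construction. An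
    integrating factor shows the same for w, which puts the trajectory on the linear flow at L t. *)
Lemma ode_flow (x y : R -> R) :
  ode_solution alpha beta gamma delta x0 y0 x y ->
  exists L : R -> R, forall t : R, 0 <= t ->
    [/\ 0 <= L t, T (L t) = t, x t = X (L t) & y t = Y (L t)].
Proof.
move=> ode; have [x_0 y_0 cx cy xp yp dx dy] := ode.
have [k0 m0 km kmd lam0] := hp.
pose v := perron_coord delta x y k; pose w := perron_coord delta x y (- m).
have v_0 : v 0 = v0 by rewrite /v /perron_coord x_0 y_0 add0r.
have w_0 : w 0 = w0 by rewrite /w /perron_coord x_0 y_0 add0r mulNr.
have vp (t : R) : 0 <= t -> 0 < v t.
  rewrite le_eqVlt => /predU1P[<-|t0]; first by rewrite v_0.
  exact: perron_coord_gt0 hp ode _ t0.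
have cv : continuous_on_halfline v by exact: perron_coord_continuous ode k.
have cw : continuous_on_halfline w by exact: perron_coord_continuous ode (- m).
(* This is ln (v / v0) / l1, normalised to vanish at time 0. *)
pose L t := - ((beta + k)^-1 * ln v0) + 1 * ((beta + k)^-1 * ln (v t)) + 0 * t.
have L0 : L 0 = 0 by rewrite /L v_0; lra.
have dL (t : R) : 0 < t -> is_derive t 1 L (x t * y t)^-1.
  move=> t0; have := is_derive_affine2 (- ((beta + k)^-1 * ln v0)) 1 0
    (perron_clock_derive delta0 hp ode t0) (is_derive_id t 1).
  by rewrite mul1r mul0r addr0.
have cL : continuous_on_halfline L.
  apply: continuous_on_halfline_affine2; last exact: continuous_on_halfline_id.
  apply: (@continuous_on_halfline_comp _ (fun r => (beta + k)^-1 * ln r) v) => // t t0.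
  by apply: cvgM; [exact: cvg_cst|exact: continuous_ln (vp t t0)].
have vL (t : R) : 0 <= t -> v t = v0 * expR ((beta + k) * L t).
  move=> t0; rewrite /L (_ : (beta + k) * _ = ln (v t) - ln v0); last first.
    by field; rewrite gt_eqF.
  rewrite expRB !lnK ?posrE ?vp//.
  by rewrite mulrC divfK// gt_eqF.
(* As w' = l2 w L', this product is constant. *)
pose h t := w t * expR (- (beta - m) * L t).
have ch : continuous_on_halfline h.
  apply: continuous_on_halfline_mul => //.
  apply: (continuous_on_halfline_comp (f := fun r => expR (- (beta - m) * r)))
    cL _ => t _.
  exact: (derivable_everywhere_continuous (is_derive_expRM _)).
have dh (t : R) : 0 < t -> is_derive t 1 h 0.
  move=> t0.
  have := is_derive_mul (perron_coord_derive2 hp ode t0)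
    (is_derive_compose (is_derive_expRM (- (beta - m)) (L t)) (dL t t0)).
  congr is_derive; rewrite -/w; ring.
have wL (t : R) : 0 <= t -> w t = w0 * expR ((beta - m) * L t).
  move=> t0; have := halfline_derive0_cst ch dh t0.
  rewrite /h L0 mulr0 expR0 mulr1 w_0 => <-.
  by rewrite -mulrA -expRD mulNr addNr expR0 mulr1.
have xL (t : R) : 0 <= t -> x t = X (L t).
  move=> t0; rewrite (perron_coord_x x y delta0 hp t) -/v -/w vL// wL//.
  by rewrite /flow_x !mulrA.
have yL (t : R) : 0 <= t -> y t = Y (L t).
  by move=> t0; rewrite (perron_coord_y x y hp t) -/v -/w vL// wL.
exists L => t t0; split; [| |exact: xL|exact: yL].
- rewrite -[leLHS]L0; apply: (halfline_derive_ge0_le cL dL) t0 => s s0.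
  by rewrite invr_ge0 mulr_ge0// ltW ?xp ?yp.
(* The derivative of T (L s) is X Y / (x y) = 1, so T (L s) - s keeps its value 0. *)
- have cE : continuous_on_halfline (fun s => 0 + 1 * T (L s) + (-1) * s).
    apply: continuous_on_halfline_affine2; last exact: continuous_on_halfline_id.
    apply: continuous_on_halfline_comp cL _ => s _.
    exact: derivable_everywhere_continuous dT _.
  have dE (s : R) : 0 < s -> is_derive s 1 (fun s => 0 + 1 * T (L s) + (-1) * s) 0.
    move=> s0; have := is_derive_affine2 0 1 (-1)
      (is_derive_compose (dT (L s)) (dL s s0)) (is_derive_id s 1).
    congr is_derive; rewrite -xL ?ltW// -yL ?ltW//.
    by rewrite mul1r mulfV ?gt_eqF ?mulr_gt0 ?xp ?yp//; lra.
  have := halfline_derive0_cst cE dE t0; rewrite L0 T0; lra.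
Qed.

End ode_from_nonorigin.

Section ode_nonorigin.
Context {R : realType} (alpha beta gamma delta x0 y0 k m : R).
Hypothesis delta0 : 0 < delta.
Hypotheses (x00 : 0 <= x0) (y00 : 0 <= y0).
Hypothesis hp : perron alpha beta gamma delta k m.
Hypothesis v00 : 0 < delta * x0 + k * y0.
Let v0 := delta * x0 + k * y0.
Let w0 := delta * x0 - m * y0.
Local Notation l1 := (beta + k).
Local Notation l2 := (beta - m).
Local Notation X := (flow_x l1 l2 k m delta v0 w0).
Local Notation Y := (flow_y l1 l2 k m v0 w0).

Let k0 : 0 < k. Proof. by case: hp. Qed.
Let m0 : 0 < m. Proof. by case: hp. Qed.
Let l10 : 0 < l1. Proof. by case: hp. Qed.
Let l21 : l2 < l1. Proof. by move: k0 m0; lra. Qed.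
Let w0_le : w0 <= v0.
Proof.
rewrite -subr_ge0 /v0 /w0 (_ : _ - _ = (k + m) * y0); last by ring.
by rewrite mulr_ge0// addr_ge0// ltW.
Qed.
Let w0_ge : 0 <= m * v0 + k * w0.
Proof.
rewrite /v0 /w0 (_ : _ + _ = (k + m) * delta * x0); last by ring.
by rewrite !mulr_ge0// ?addr_ge0// ltW.
Qed.

(** Both trajectories follow the same flow, and injectivity of T leaves one value for the time
    change at t. *)
Lemma ode_unique_nonorigin (x y x' y' : R -> R) :
  ode_solution alpha beta gamma delta x0 y0 x y ->
  ode_solution alpha beta gamma delta x0 y0 x' y' ->
  forall t : R, 0 <= t -> x' t = x t /\ y' t = y t.
Proof.
move=> ode ode' t t0.
have [T T0 dT] := flow_clock l1 l2 v0 w0 k0 m0 delta0.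
have [L /(_ t t0)[L0 TL -> ->]] := ode_flow delta0 hp v00 T0 dT ode.
have [L' /(_ t t0)[L'0 TL' -> ->]] := ode_flow delta0 hp v00 T0 dT ode'.
have inj := flow_clock_inj l21 l10 k0 m0 delta0 v00 w0_le w0_ge dT.
by have -> : L' t = L t by apply: inj => //; rewrite TL.
Qed.

Lemma flow_x_derive (u : R) : is_derive u 1 X (beta * X u + alpha * Y u).
Proof.
have := is_derive_affine2 0 (m * v0 / (delta * (k + m)))
  (k * w0 / (delta * (k + m))) (is_derive_expRM l1 u) (is_derive_expRM l2 u).
rewrite (_ : (fun _ => _) = X); last first.
  by apply/funext => r; rewrite /flow_x; ring.
congr is_derive; have [_ _ km _ _] := hp.
have -> : alpha = k * m / delta by rewrite km; field; rewrite gt_eqF.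
by rewrite /flow_x /flow_y; field; rewrite !gt_eqF// addr_gt0.
Qed.

Lemma flow_y_derive (u : R) : is_derive u 1 Y (gamma * Y u + delta * X u).
Proof.
have := is_derive_affine2 0 (v0 / (k + m))
  (- w0 / (k + m)) (is_derive_expRM l1 u) (is_derive_expRM l2 u).
rewrite (_ : (fun _ => _) = Y); last first.
  by apply/funext => r; rewrite /flow_y; ring.
congr is_derive; have [_ _ _ kmd _] := hp.
have -> : gamma = beta + k - m by lra.
by rewrite /flow_x /flow_y; field; rewrite !gt_eqF// addr_gt0.
Qed.

(** Run the flow at the inverse U of its clock: dividing beta X + alpha Y by X Y gives alpha / X +
    beta / Y, and likewise for the second equation. *)
Lemma ode_exists_nonorigin :
  exists x y, ode_solution alpha beta gamma delta x0 y0 x y.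
Proof.
have [T T0 dT] := flow_clock l1 l2 v0 w0 k0 m0 delta0.
have incr := flow_clock_incr l21 l10 k0 m0 delta0 v00 w0_le w0_ge dT.
have inj := flow_clock_inj l21 l10 k0 m0 delta0 v00 w0_le w0_ge dT.
have surj := flow_clock_surj l21 l10 k0 m0 delta0 v00 w0_le w0_ge T0 dT.
have Xp := flow_x_gt0 l21 l10 k0 m0 delta0 v00 w0_ge.
have Yp := flow_y_gt0 l21 l10 k0 m0 v00 w0_le.
have Tge0 (u : R) : 0 <= u -> 0 <= T u.
  by rewrite le_eqVlt => /predU1P[<-|u0]; [rewrite T0|rewrite -[leLHS]T0 ltW// incr].
(* The condition on t sits inside the existential, so that choice yields a total function; its
   values at negative times are arbitrary. *)
have : forall t : R, exists u : R, 0 <= t -> 0 <= u /\ T u = t.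
  move=> t; have [t0|t0] := leP 0 t; last by exists 0.
  by have [u u0 Tu] := surj t t0; exists u.
move=> /choice[U HU].
have U0 (t : R) : 0 <= t -> 0 <= U t by move=> /HU[].
have TU (t : R) : 0 <= t -> T (U t) = t by move=> /HU[].
have UT (u : R) : 0 <= u -> U (T u) = u.
  by move=> u0; apply: inj => //; [exact/U0/Tge0|exact/TU/Tge0].
have U_0 : U 0 = 0 by rewrite -{1}T0 UT.
have Up (t : R) : 0 < t -> 0 < U t.
  move=> t0; rewrite lt_neqAle U0 ?(ltW t0)// andbT; apply/eqP => Ut.
  by have := TU t (ltW t0); rewrite -Ut T0 => tE; rewrite -tE ltxx in t0.
have dU (t : R) : 0 < t -> is_derive t 1 U (X (U t) * Y (U t))^-1.
  move=> t0; rewrite -{1}(TU t (ltW t0)); apply: is_derive_inverse.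
  - near=> u; apply: UT; apply: ltW; near: u; exact: lt_nbhsr (Up t t0).
  - by near=> u; exact: derivable_everywhere_continuous dT u.
  - by rewrite gt_eqF// mulr_gt0 ?Xp ?Yp ?Up.
have cU : continuous_on_halfline U.
  apply/continuous_within_itvcyP; split=> [t|].
    rewrite in_itv/= andbT => t0; apply/differentiable_continuous/derivable1_diffP.
    by have [] := dU t t0.
  (* At 0 the slope X Y of T may vanish, so right continuity of U comes from monotonicity: t < T e
     forces U t < e. *)
  rewrite U_0; apply/cvgrPdist_lt => e e0; near=> t.
  have t0 : 0 < t by near: t; exact: nbhs_right_gt.
  have tT : t < T e.
    by near: t; apply: nbhs_right_lt; rewrite -[ltLHS]T0 incr.
  rewrite sub0r normrN gtr0_norm ?Up// ltNge; apply/negP => eU.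
  have : T e <= T (U t).
    by move: eU; rewrite le_eqVlt => /predU1P[->//|eU]; rewrite ltW// incr// ltW.
  by rewrite TU ?(ltW t0)// leNgt tT.
exists (fun t => X (U t)), (fun t => Y (U t)); split.
- rewrite U_0 /flow_x !mulr0 expR0 /v0 /w0; field.
  by rewrite !gt_eqF// addr_gt0.
- rewrite U_0 /flow_y !mulr0 expR0 /v0 /w0; field.
  by rewrite !gt_eqF// addr_gt0.
- apply: continuous_on_halfline_comp cU _ => t _.
  exact: derivable_everywhere_continuous flow_x_derive _.
- apply: continuous_on_halfline_comp cU _ => t _.
  exact: derivable_everywhere_continuous flow_y_derive _.
- by move=> t t0; exact/Xp/Up.
- by move=> t t0; exact/Yp/Up.
- move=> t t0; have Xt := Xp _ (Up t t0); have Yt := Yp _ (Up t t0).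
  have := is_derive_compose (flow_x_derive (U t)) (dU t t0).
  by congr is_derive; field; rewrite !gt_eqF.
- move=> t t0; have Xt := Xp _ (Up t t0); have Yt := Yp _ (Up t t0).
  have := is_derive_compose (flow_y_derive (U t)) (dU t t0).
  by congr is_derive; field; rewrite !gt_eqF.
Unshelve. all: by end_near. Qed.

End ode_nonorigin.

(** * Start at the origin *)

Section ode_origin.
Context {R : realType} (alpha beta gamma delta k m : R).
Hypothesis delta0 : 0 < delta.
Hypothesis hp : perron alpha beta gamma delta k m.
Local Notation l1 := (beta + k).
Local Notation l2 := (beta - m).

Let k0 : 0 < k. Proof. by case: hp. Qed.
Let m0 : 0 < m. Proof. by case: hp. Qed.
Let l10 : 0 < l1. Proof. by case: hp. Qed.

Lemma ode_origin_ray (x y : R -> R) :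
  ode_solution alpha beta gamma delta 0 0 x y ->
  forall t : R, 0 < t -> delta * x t = m * y t.
Proof.
move=> ode t t0; have [x_0 y_0 cx cy xp yp dx dy] := ode.
pose v := perron_coord delta x y k; pose w := perron_coord delta x y (- m).
suff : w t = 0 by rewrite /w /perron_coord; lra.
apply/eqP/negP => /negP wt.
have vp (s : R) : 0 < s -> 0 < v s by exact: perron_coord_gt0 hp ode s.
(* Here v vanishes at time 0, so L cannot be normalised there. *)
pose L s := l1^-1 * ln (v s).
have vL (s : R) : 0 < s -> v s = expR (l1 * L s).
  by move=> s0; rewrite /L mulrA mulfV ?gt_eqF// mul1r lnK// posrE vp.
pose h s := w s * expR (- l2 * L s).
have dh (s : R) : 0 < s -> is_derive s 1 h 0.
  move=> s0; have := is_derive_mul (perron_coord_derive2 hp ode s0)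
    (is_derive_compose (is_derive_expRM (- l2) (L s))
      (perron_clock_derive delta0 hp ode s0)).
  by congr is_derive; rewrite -/w; ring.
have ht : 0 < `|h t| by rewrite normr_gt0 mulf_neq0// gt_eqF// expR_gt0.
(* With this C, C v is delta x + m y plus nonnegative terms, hence at least |w|. *)
pose C := 1 + m / k.
have C0 : 0 < C by rewrite addr_gt0// divr_gt0.
have hC (s : R) : 0 < s -> `|h s| <= C * expR ((k + m) * L s).
  move=> s0; rewrite normrM [`|expR _|]ger0_norm ?expR_ge0//.
  rewrite (_ : (k + m) * L s = l1 * L s + - l2 * L s); last by ring.
  rewrite expRD -vL// mulrA ler_pM2r ?expR_gt0//.
  have xs := xp s s0; have ys := yp s s0.
  rewrite (_ : C * v s = delta * x s + m * y s +
    (delta * (m / k) * x s + k * y s)); last first.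
    by rewrite /C /v /perron_coord; field; rewrite gt_eqF.
  have p1 : 0 < delta * x s by rewrite mulr_gt0.
  have p2 : 0 < m * y s by rewrite mulr_gt0.
  have p3 : 0 < delta * (m / k) * x s by rewrite !mulr_gt0// invr_gt0.
  have p4 : 0 < k * y s by rewrite mulr_gt0.
  by rewrite /w /perron_coord ler_norml; apply/andP; split; lra.
(* The value of v at which the bound C exp ((k + m) L) equals |h t|. Near time 0 v is below b, which
   contradicts the constancy of h. *)
pose b := expR (l1 * ((k + m)^-1 * ln (`|h t| / C))).
have cv : continuous_on_halfline v by exact: perron_coord_continuous ode k.
have v_0 : v 0 = 0 by rewrite /v /perron_coord x_0 y_0 !mulr0 !addr0.
have [s [s0 st vs]] : exists s : R, [/\ 0 < s, s < t & v s < b].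
  have /continuous_within_itvcyP[_ cv0] := cv.
  have vb : \forall s \near 0^'+, v s < b.
    by apply: (cvgr_lt _ cv0); rewrite v_0 expR_gt0.
  near (0 : R)^'+ => s; exists s; split.
  - by near: s; exact: nbhs_right_gt.
  - by near: s; exact: nbhs_right_lt.
  - by near: s.
have := hC s s0; rewrite -(positive_derive0_cst dh s0 st); apply/negP; rewrite -ltNge.
rewrite mulrC -ltr_pdivlMr// -[ltRHS]lnK ?posrE ?divr_gt0// ltr_expR.
rewrite mulrC -ltr_pdivlMr ?addr_gt0// [ltRHS]mulrC -(ltr_pM2l l10).
by rewrite -ltr_expR -vL.
Unshelve. all: by end_near. Qed.

Lemma ode_unique_origin (x y x' y' : R -> R) :
  ode_solution alpha beta gamma delta 0 0 x y ->
  ode_solution alpha beta gamma delta 0 0 x' y' ->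
  forall t : R, 0 <= t -> x' t = x t /\ y' t = y t.
Proof.
(* On the ray delta x = m y the second equation reads y' = delta l1 / (m y), so y ^ 2 has the
   constant derivative c. *)
pose c := 2 * delta * l1 / m.
have sq x1 y1 : ode_solution alpha beta gamma delta 0 0 x1 y1 ->
    forall t : R, 0 <= t -> x1 t = m / delta * y1 t /\ y1 t ^+ 2 = c * t.
  move=> ode t t0; have [x_0 y_0 cx cy xp yp dx dy] := ode.
  have xy (s : R) : 0 <= s -> x1 s = m / delta * y1 s.
    rewrite le_eqVlt => /predU1P[<-|s0]; first by rewrite x_0 y_0 mulr0.
    by rewrite mulrAC -(ode_origin_ray ode s0); field; rewrite gt_eqF.
  split; first exact: xy.
  have cE : continuous_on_halfline (fun s => 0 + 1 * (y1 s * y1 s) + (- c) * s).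
    apply: continuous_on_halfline_affine2; last exact: continuous_on_halfline_id.
    exact: continuous_on_halfline_mul.
  have dE (s : R) : 0 < s ->
      is_derive s 1 (fun s => 0 + 1 * (y1 s * y1 s) + (- c) * s) 0.
    move=> s0; have ys := yp s s0.
    have := is_derive_affine2 0 1 (- c) (is_derive_mul (dy s s0) (dy s s0))
      (is_derive_id s 1).
    congr is_derive; rewrite (xy s (ltW s0)) /c.
    have [_ _ _ kmd _] := hp; have -> : gamma = beta + k - m by lra.
    by field; rewrite !gt_eqF.
  by have := halfline_derive0_cst cE dE t0; rewrite y_0 expr2; lra.
move=> ode ode' t t0; have [-> ysq] := sq _ _ ode t t0.
have [-> ysq'] := sq _ _ ode' t t0.
have nn x1 y1 : ode_solution alpha beta gamma delta 0 0 x1 y1 -> 0 <= y1 t.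
  case=> _ y_0 _ _ _ yp _ _; move: t0; rewrite le_eqVlt => /predU1P[<-|/yp/ltW//].
  by rewrite y_0.
suff -> : y' t = y t by [].
apply/eqP; rewrite -(@eqrXn2 _ 2)//; first by rewrite ysq ysq'.
- exact: nn ode'.
- exact: nn ode.
Qed.

Lemma ode_exists_origin :
  exists x y, ode_solution alpha beta gamma delta 0 0 x y.
Proof.
pose c := 2 * delta * l1 / m.
have c0 : 0 < c by rewrite divr_gt0 ?mulr_gt0.
(* The uniqueness argument forces y ^ 2 = c t and x = (m / delta) y. *)
pose y (t : R) := Num.sqrt (c * t).
have yp (t : R) : 0 < t -> 0 < y t by move=> t0; rewrite sqrtr_gt0 mulr_gt0.
have cy : continuous_on_halfline y.
  apply: continuous_subspaceT => t; apply: continuous_comp; last exact: sqrt_continuous.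
  by apply: cvgM; [exact: cvg_cst|exact: cvg_id].
have dy (t : R) : 0 < t -> is_derive t 1 y (delta * l1 / (m * y t)).
  move=> t0; have yt := yp t t0.
  have ct : 0 < c * t by rewrite mulr_gt0.
  have := is_derive_compose (is_derive1_sqrt ct) (is_deriveZ c (is_derive_id t 1)).
  congr is_derive; rewrite -/(y t) [_ *: _]mulr1 /c.
  by field; rewrite !gt_eqF.
have [_ _ km kmd _] := hp.
exists (fun t => 0 + (m / delta) * y t + 0 * t), y; split.
- by rewrite /y !mulr0 sqrtr0 mulr0 !addr0.
- by rewrite /y mulr0 sqrtr0.
- by apply: continuous_on_halfline_affine2 => //; exact: continuous_on_halfline_id.
- exact: cy.
- by move=> t t0; rewrite mul0r add0r addr0 mulr_gt0 ?divr_gt0 ?yp.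
- exact: yp.
- move=> t t0; have yt := yp t t0.
  have := is_derive_affine2 0 (m / delta) 0 (dy t t0) (is_derive_id t 1).
  have -> : alpha = k * m / delta by rewrite km; field; rewrite gt_eqF.
  by congr is_derive; rewrite !(mul0r, add0r, addr0); field; rewrite !gt_eqF.
- move=> t t0; have yt := yp t t0; have := dy t t0.
  have -> : gamma = beta + k - m by lra.
  by congr is_derive; field; rewrite !gt_eqF.
Qed.

End ode_origin.

(** * Existence and uniqueness for all starting points *)

Theorem theorem1 (R : realType) (alpha beta gamma delta : R)
    (halpha : 0 < alpha) (hdelta : 0 < delta)
    (hparam : 0 <= Num.max beta gamma \/ beta * gamma < alpha * delta)
    (x0 y0 : R) (hx0 : 0 <= x0) (hy0 : 0 <= y0) :
  exists x y : R -> R,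
    is_solution alpha beta gamma delta x0 y0 x y /\
    (forall x' y' : R -> R,
       is_solution alpha beta gamma delta x0 y0 x' y' ->
       forall t : R, 0 <= t -> x' t = x t /\ y' t = y t).
Proof.
have [k [m hp]] := perron_exists halpha hdelta hparam.
have [k0 _ _ _ _] := hp.
suff [x [y [ode uniq]]] : exists x y : R -> R,
    ode_solution alpha beta gamma delta x0 y0 x y /\
    (forall x' y' : R -> R,
       ode_solution alpha beta gamma delta x0 y0 x' y' ->
       forall t : R, 0 <= t -> x' t = x t /\ y' t = y t).
  exists x, y; split; first exact: ode_is_solution hp ode.
  by move=> x' y' sol; apply: uniq; exact: solution_ode hp sol.
(* In the closed quadrant, delta x0 + k y0 vanishes only at the origin. *)
have [v0|] := ltP 0 (delta * x0 + k * y0).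
  have [x [y ode]] := ode_exists_nonorigin hdelta hx0 hy0 hp v0.
  exists x, y; split=> // x' y'; exact: ode_unique_nonorigin hp v0 _ _ _ _ ode.
have dx0 : 0 <= delta * x0 by rewrite mulr_ge0// ltW.
have ky0 : 0 <= k * y0 by rewrite mulr_ge0// ltW.
move=> v0.
have x00 : x0 = 0.
  by apply/eqP; rewrite -(mulrI_eq0 _ (lregP (lt0r_neq0 hdelta))); apply/eqP; lra.
have y00 : y0 = 0.
  by apply/eqP; rewrite -(mulrI_eq0 _ (lregP (lt0r_neq0 k0))); apply/eqP; lra.
rewrite {}x00 {}y00 in hx0 hy0 *.
have [x [y ode]] := ode_exists_origin hdelta hp.
by exists x, y; split=> // x' y'; exact: ode_unique_origin hdelta hp _ _ _ _ ode.
Qed.
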